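(* Let $d\ge1$, $\lambda>0$, and let $E_1(\lambda)=\lambda\,\mathrm{Id}$ be the $d\times d$ matrix with $\lambda$ on the diagonal and $0$ elsewhere. The function $\rho_1$ defined for $\xi\in\mathbb{R}^d$ by $$\rho_1(\xi)=|\xi|^{1/\lambda}$$ is an $(\mathbb{R}^d,E_1^t(\lambda))$ pseudo-norm.
   Context: $|\cdot|$ is the Euclidean norm on $\mathbb{R}^d$; $M^t$ denotes the transpose of $M$. For $a>0$ and a real square matrix $M$, $a^{M}=\exp(M\log a)$. For a real $d\times d$ matrix $M$ whose eigenvalues all have positive real parts, an $(\mathbb{R}^d,M)$ pseudo-norm is a continuous function $\rho:\mathbb{R}^d\to\mathbb{R}$ that is positive on $\mathbb{R}^d\setminus\{0\}$ and satisfies $\rho(a^{M}x)=a\rho(x)$ for all $x\in\mathbb{R}^d$, $a>0$. *)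

(* Defs.v *)
From HB Require Import structures.
From mathcomp Require Import all_boot all_order all_algebra.
From mathcomp Require Import all_classical all_reals all_analysis.
From mathcomp Require Import complex.

Set Implicit Arguments.
Unset Strict Implicit.
Unset Printing Implicit Defensive.

Import Order.TTheory GRing.Theory Num.Theory.
Import numFieldNormedType.Exports.

Local Open Scope classical_set_scope.
Local Open Scope ring_scope.

(* The library norm `|x| on matrices is the max norm, hence this definition. *)
Definition enorm (R : realType) (d : nat) (x : 'cV[R]_d) : R :=
  Num.sqrt (\sum_(i < d) x i 0 ^+ 2).

Definition expmx (R : realType) (d : nat) (M : 'M[R]_d) : 'M[R]_d :=
  limn (series (fun k : nat => (k`!%:R)^-1 *: M ^+ k)).

(* a^M = exp(M log a), meant for 0 < a *)
Definition powmx (R : realType) (d : nat) (a : R) (M : 'M[R]_d) : 'M[R]_d :=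
  expmx (ln a *: M).

(* The eigenvalues are the complex ones: a real matrix may have no real one. *)
Definition eigenvalues_Re_gt0 (R : realType) (d : nat) (M : 'M[R]_d) : Prop :=
  forall z : R[i],
    eigenvalue (map_mx (real_complex R) M) z -> 0 < complex.Re z.

Definition is_pseudo_norm (R : realType) (d : nat) (M : 'M[R]_d)
    (rho : 'cV[R]_d -> R) : Prop :=
  [/\ eigenvalues_Re_gt0 M,
      continuous rho,
      forall x : 'cV[R]_d, x != 0 -> 0 < rho x
    & forall (a : R) (x : 'cV[R]_d), 0 < a -> rho (powmx a M *m x) = a * rho x].

(* Main.v *)
Require Import Defs.
From HB Require Import structures.
From mathcomp Require Import all_boot all_order all_algebra.
From mathcomp Require Import all_classical all_reals all_analysis.
From mathcomp Require Import complex.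

Import Order.TTheory GRing.Theory Num.Theory.
Import numFieldNormedType.Exports.

Local Open Scope classical_set_scope.
Local Open Scope ring_scope.

(** A scalar matrix has a scalar exponential ([expmx_scalar]), so the power of [a] with exponent
    lambda Id is a^lambda Id. Homogeneity of the Euclidean norm ([enormZ]) then gives (a^lambda
    |x|)^(1/lambda) = a |x|^(1/lambda). The only eigenvalue is lambda > 0, and continuity, delicate
    only at the origin, comes from 1/lambda > 0 ([powR_norm_continuous]). *)

Lemma enormZ (R : realType) (d : nat) (c : R) (x : 'cV[R]_d) :
  enorm (c *: x) = `|c| * enorm x.
Proof.
rewrite /enorm; under eq_bigr do rewrite mxE exprMn.
by rewrite -mulr_sumr sqrtrM ?sqr_ge0// sqrtr_sqr.
Qed.

Lemma enorm_gt0 (R : realType) (d : nat) (x : 'cV[R]_d) :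
  x != 0 -> 0 < enorm x.
Proof.
apply: contraNT; rewrite sqrtr_gt0 -leNgt => sum_le0.
apply/eqP/colP => i; rewrite mxE; apply/eqP; rewrite -sqrf_eq0 eq_le sqr_ge0 andbT.
apply: le_trans sum_le0; rewrite (bigD1 i)//= lerDl.
by apply: sumr_ge0 => j _; exact: sqr_ge0.
Qed.

Lemma enorm_continuous (R : realType) (d : nat) :
  continuous (@enorm R d).
Proof.
move=> x; apply: (@continuous_comp _ _ _ _ Num.sqrt); last exact: sqrt_continuous.
apply: (@continuous_big _ _ +%R) => [|i _ {}x]; first exact: add_continuous.
apply: (@continuous_comp _ _ _ (fun y : 'cV[R]_d => y i 0) (fun t => t ^+ 2)).
  exact: coord_continuous.
exact: exprn_continuous.
Qed.

(* The absolute value is needed for continuity at 0: [powR] is 1 at negative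
   reals. *)
Lemma powR_norm_continuous (R : realType) (p : R) :
  0 < p -> continuous (fun y : R => `|y| `^ p).
Proof.
move=> p0 /= y; have [->|y0] := eqVneq y 0.
  apply/cvgrPdist_lt => e e0; rewrite normr0 powR0 ?gt_eqF//.
  near=> z; rewrite sub0r normrN ger0_norm ?powR_ge0//.
  (* The radius is e^(1/p): since t^p is increasing on t >= 0, |z| < e^(1/p) forces |z|^p < e. *)
  have -> : e = (e `^ p^-1) `^ p.
    by rewrite -powRrM mulVf ?gt_eqF// powRr1// ltW.
  apply: gt0_ltr_powR; rewrite ?nnegrE ?powR_ge0//.
  near: z; apply: cvgr0_norm_lt; [exact: cvg_id|exact: powR_gt0].
(* Points near y != 0 are nonzero, so there the power is exp(p ln |z|), a composite of continuous
   maps. *)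
apply: (@cvg_trans _ ((fun z => expR (p * ln `|z|)) @ y)).
  apply: near_eq_cvg; near=> z; rewrite /powR normr_eq0 ifN//.
  by near: z; apply: (cvgr_neq0 y) => //; exact: cvg_id.
rewrite /powR normr_eq0 (negbTE y0).
have ln_norm : {for y, continuous (@ln R \o (fun z : R => `|z|))}.
  apply: continuous_comp; first exact: norm_continuous.
  by apply: continuous_ln; rewrite normr_gt0.
have p_ln_norm : {for y, continuous (fun z => p * ln `|z|)}.
  exact: cvgMl_tmp ln_norm.
exact: (@continuous_comp _ _ _ _ expR _ p_ln_norm (@continuous_expR R _)).
Unshelve. all: by end_near. Qed.

(** Each partial sum is the scalar exponential partial sum times the identity, and scaling a fixed
    matrix is continuous, so the limit passes through. *)
Lemma expmx_scalar (R : realType) (d : nat) (c : R) :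
  expmx (c%:M : 'M[R]_d) = (expR c)%:M.
Proof.
apply: cvg_lim; first exact: norm_hausdorff.
have -> : series (fun k : nat => (k`!%:R)^-1 *: (c%:M : 'M[R]_d) ^+ k) =
    (fun n => series (exp_coeff c) n *: (1%:M : 'M[R]_d)).
  apply/funext => n; rewrite /series /= scaler_suml; apply: eq_bigr => k _.
  by rewrite -rmorphXn /= scale_scalar_mx scalemx1 mulrC.
by rewrite -[(expR c)%:M]scalemx1; apply: cvgZr_tmp; exact: is_cvg_series_exp_coeff.
Qed.

Theorem lemma3p1 (R : realType) (d : nat) (lambda : R)
    (hd : (1 <= d)%N) (hlambda : 0 < lambda) :
  is_pseudo_norm ((lambda%:M : 'M[R]_d)^T)
    (fun xi : 'cV[R]_d => enorm xi `^ (1 / lambda)).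
Proof.
rewrite tr_scalar_mx div1r; split.
(* An eigenvector v satisfies (lambda - z) v = 0 with v nonzero, hence z = lambda. *)
- move=> z /eigenvalueP[v]; rewrite map_scalar_mx mul_mx_scalar => /eqP.
  rewrite -subr_eq0 -scalerBl scaler_eq0 subr_eq0 => /orP[/eqP <- //|/eqP ->].
  by rewrite eqxx.
(* As [enorm] is nonnegative, inserting the absolute value changes nothing and makes the outer map
   continuous on all of R. *)
- have -> : (fun xi : 'cV[R]_d => enorm xi `^ lambda^-1) =
      (fun y => `|y| `^ lambda^-1) \o @enorm R d.
    by apply/funext => xi /=; rewrite ger0_norm ?sqrtr_ge0.
  move=> x; apply: continuous_comp; first exact: enorm_continuous.
  by apply: powR_norm_continuous; rewrite invr_gt0.
- by move=> x x0; rewrite powR_gt0 ?enorm_gt0.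
- move=> a x a0; rewrite /powmx scale_scalar_mx expmx_scalar mul_scalar_mx.
  rewrite enormZ ger0_norm ?expR_ge0// powRM ?expR_ge0 ?sqrtr_ge0//.
  (* Turns exp(lambda ln a) into a^lambda, which the outer exponent 1/lambda then undoes. *)
  rewrite [ln a * _]mulrC -ln_powR lnK ?posrE ?powR_gt0//.
  by rewrite -powRrM mulfV ?gt_eqF// powRr1 ?ltW.
Qed.
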